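(* Let $d\ge1$ and $\lambda=(d-1)/2$. (a) For all $n\in\mathbb{N}_0$, $\eta\in\mathbb{S}_d$ and $-1\le\alpha,\beta\le1$, $$\int\Delta^\lambda_{n,\zeta,\alpha}(A)\,\Delta^\lambda_{n,\eta,\beta}(d\zeta)=\Delta^\lambda_{n,\eta,\gamma_n^\lambda\alpha\beta}(A)=(1-\gamma_n^\lambda)\,\mathrm{unif}(\mathbb{S}_d)(A)+\gamma_n^\lambda\,\Delta^\lambda_{n,\eta,\alpha\beta}(A)$$ for all $A\in\mathcal{B}(\mathbb{S}_d)$. (b) For all $n,m\in\mathbb{N}_0$ with $n\ne m$, and all $\eta\in\mathbb{S}_d$, $-1\le\alpha,\beta\le1$, $$\int\Delta^\lambda_{m,\zeta,\alpha}(A)\,\Delta^\lambda_{n,\eta,\beta}(d\zeta)=\mathrm{unif}(\mathbb{S}_d)(A)\quad\text{for all }A\in\mathcal{B}(\mathbb{S}_d).$$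
   Context: $\mathbb{S}_d=\{x\in\mathbb{R}^{d+1}:\|x\|=1\}$ with Borel $\sigma$-field $\mathcal{B}(\mathbb{S}_d)$ and uniform distribution $\mathrm{unif}(\mathbb{S}_d)$; $\eta^{t}x$ is the Euclidean inner product; $\mathbb{N}=\{1,2,\dots\}$, $\mathbb{N}_0=\mathbb{N}\cup\{0\}$; $(\alpha)_n=\Gamma(\alpha+n)/\Gamma(\alpha)$. $D_n^0=T_n$ is the Chebyshev polynomial of the first kind of degree $n$; for $\lambda>0$, $D_n^\lambda=C_n^\lambda/C_n^\lambda(1)$ with $C_n^\lambda$ the Gegenbauer (ultraspherical) polynomial of degree $n$, $C_n^\lambda(1)=(2\lambda)_n/n!$. For $n\in\mathbb{N}$ and $-1\le\alpha\le1$, $\Delta^\lambda_{n,\eta,\alpha}$ is the probability distribution on $\mathbb{S}_d$ with $\mathrm{unif}(\mathbb{S}_d)$-density $x\mapsto1+\alpha D_n^\lambda(\eta^{t}x)$; $\Delta^\lambda_{0,\eta,\alpha}=\mathrm{unif}(\mathbb{S}_d)$. The constants are $\gamma^0_0=1$, $\gamma^0_n=1/2$ for $n\in\mathbb{N}$, and $\gamma^\lambda_n=\frac{1}{(1+n/\lambda)\,C_n^\lambda(1)}$ for $\lambda>0$, $n\in\mathbb{N}_0$. *)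

(* Defs.v *)
(* MathComp / MathComp-Analysis *)
From HB Require Import structures.
From mathcomp Require Import all_boot all_order all_algebra.
From mathcomp Require Import all_classical all_reals all_analysis.
Set Implicit Arguments.
Unset Strict Implicit.
Unset Printing Implicit Defensive.
Import Order.TTheory GRing.Theory Num.Theory.
Import numFieldNormedType.Exports.
Local Open Scope classical_set_scope.
Local Open Scope ring_scope.

Definition dotp (R : realType) (n : nat) (u v : 'rV[R]_n) : R :=
  \sum_i u 0 i * v 0 i.

(* The library norm `|x| on 'rV[R]_n is the sup norm (same topology); the
   sphere needs the Euclidean one. *)
Definition enorm (R : realType) (n : nat) (u : 'rV[R]_n) : R :=
  Num.sqrt (dotp u u).

Definition unit_sphere (R : realType) (d : nat) : set 'rV[R]_d.+1 :=
  [set x | enorm x = 1].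

Lemma unit_sphere_delta (R : realType) (d : nat) :
  unit_sphere (delta_mx 0 0 : 'rV[R]_d.+1).
Proof.
rewrite /unit_sphere /= /enorm /dotp (bigD1 ord0) //= big1 => [|i i0].
  by rewrite addr0 mxE !eqxx mulr1 sqrtr1.
by rewrite mxE (negbTE i0) andbF mulr0.
Qed.

HB.instance Definition _ (R : realType) (d : nat) :=
  isPointed.Build (set_type (@unit_sphere R d))
    (SigSub (mem_set (unit_sphere_delta R d))).

(* The sphere in R^(d+1), with the Borel sigma-field of its trace topology. *)
Definition sphere (R : realType) (d : nat) :=
  g_sigma_algebraType (@open (set_type (@unit_sphere R d))).

Definition svec (R : realType) (d : nat) (x : sphere R d) : 'rV[R]_d.+1 :=
  @set_val _ (@unit_sphere R d) x.

(* The uniform distribution is the probability on the Borel sets of the sphere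
   that is invariant under all orthogonal maps a |-> a *m Q (this determines
   it uniquely). *)
Definition is_unif (R : realType) (d : nat)
    (unif : probability (sphere R d) R) : Prop :=
  forall Q : 'M[R]_d.+1, Q *m Q^T = 1%:M ->
  forall A : set (sphere R d), measurable A ->
    unif [set x | exists2 a, A a & svec x = svec a *m Q] = unif A.

Fixpoint chebyshev (R : realType) (n : nat) : {poly R} :=
  match n with
  | 0%N => 1
  | n1.+1 =>
    match n1 with
    | 0%N => 'X
    | n2.+1 => 2 *: ('X * chebyshev R n1) - chebyshev R n2
    end
  end.

(* Three-term recurrence
   k C_k = 2 (k + l - 1) X C_(k-1) - (k + 2 l - 2) C_(k-2). *)
Fixpoint gegenbauer (R : realType) (l : R) (n : nat) : {poly R} :=
  match n with
  | 0%N => 1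
  | n1.+1 =>
    match n1 with
    | 0%N => (2 * l) *: 'X
    | n2.+1 =>
      n%:R^-1 *: ((2 * (n%:R + l - 1)) *: ('X * gegenbauer l n1)
                  - (n%:R + 2 * l - 2) *: gegenbauer l n2)
    end
  end.

Definition Dpoly (R : realType) (l : R) (n : nat) : {poly R} :=
  if l == 0 then chebyshev R n
  else (gegenbauer l n).[1]^-1 *: gegenbauer l n.

Definition gammac (R : realType) (l : R) (n : nat) : R :=
  if l == 0 then (if n == 0%N then 1 else 2^-1)
  else ((1 + n%:R / l) * (gegenbauer l n).[1])^-1.

Local Open Scope ereal_scope.

(* A |-> Delta^l_(n, eta, alpha)(A), as a set function: the library integral
   \int[mu] is defined for every set function mu, so no proof that this is a
   probability (which holds for -1 <= alpha <= 1 and l = (d - 1) / 2) is needed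
   in order to integrate with respect to it. *)
Definition Delta (R : realType) (d : nat) (unif : probability (sphere R d) R)
    (l : R) (n : nat) (eta : sphere R d) (alpha : R) :
    set (sphere R d) -> \bar R :=
  fun A =>
    if n == 0%N then unif A
    else \int[unif]_(x in A)
           (1 + alpha * (Dpoly l n).[dotp (svec eta) (svec x)])%:E.

(* Main.v *)
(* The uniform law is invariant under reflections, hence under infinitesimal
   rotations. Writing u = eta^t zeta, w = x^t zeta and t = eta^t x, this yields
   the integration by parts formula
     E[(1 - u^2) p'(u) q(w) + (t - u w) p(u) q'(w)] = d E[u p(u) q(w)]
   for all polynomials p, q. Since D_n satisfies the ultraspherical differential
   equation with eigenvalue -n(n + 2 lambda), the formula gives
   E[D_n(u) D_m(w)] = 0 for n <> m. For n = m the integral is a polynomial Q(t)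
   of degree at most n which, by Fubini, is orthogonal to D_m for m < n, so Q is
   a multiple of D_n; the value E[D_n(u)^2] = gamma_n of Q(1) comes from the
   three-term recurrence. Thus E[D_n(u) D_m(w)] is 0 or gamma_n D_n(t), and both
   parts of the proposition follow by Fubini. The same identity and
   E[(D_n(u) +- D_n(w))^2] >= 0 give |D_n| <= 1 on [-1, 1], so the Delta are
   genuine measures. *)
Require Import Defs.
From HB Require Import structures.
From mathcomp Require Import all_boot all_order all_algebra.
From mathcomp Require Import all_classical all_reals all_analysis.
From mathcomp Require Import measurable_realfun ring lra.
Set Implicit Arguments.
Unset Strict Implicit.
Unset Printing Implicit Defensive.
Import Order.TTheory GRing.Theory Num.Theory.
Import numFieldNormedType.Exports.
Local Open Scope classical_set_scope.
Local Open Scope ring_scope.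

(** * Ultraspherical polynomials *)

Lemma nat_ind2 (Q : nat -> Prop) :
  Q 0%N -> Q 1%N -> (forall n, Q n -> Q n.+1 -> Q n.+2) -> forall n, Q n.
Proof.
move=> Q0 Q1 QS n; suff [] : Q n /\ Q n.+1 by [].
by elim: n => [//|n [? ?]]; split => //; exact: QS.
Qed.

Lemma gegenbauerSS (R : realType) (l : R) (n : nat) :
  gegenbauer l n.+2 = n.+2%:R^-1 *:
    ((2 * (n.+2%:R + l - 1)) *: ('X * gegenbauer l n.+1)
     - (n.+2%:R + 2 * l - 2) *: gegenbauer l n).
Proof. by []. Qed.

(** This recursion encodes [C_n(1) = (2 l)_n / n!]. At 1 the last coefficient [n + 2 + 2 l - 2] of
    the three-term recurrence is the factor [2 l + n] of the previous instance, so induction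
    closes. *)
Lemma gegenbauer_at1S (R : realType) (l : R) (n : nat) :
  n.+1%:R * (gegenbauer l n.+1).[1] = (2 * l + n%:R) * (gegenbauer l n).[1].
Proof.
elim: n => [|n IH]; first by rewrite /= hornerZ hornerX hornerC; ring.
rewrite gegenbauerSS hornerZ mulrA divff ?pnatr_eq0// mul1r.
rewrite hornerD hornerN !hornerZ hornerM hornerX mul1r.
have -> : (n.+2%:R + 2 * l - 2) * (gegenbauer l n).[1]
        = (2 * l + n%:R) * (gegenbauer l n).[1] by congr (_ * _); ring.
by rewrite -IH; ring.
Qed.

Lemma gegenbauer_at1_gt0 (R : realType) (l : R) (n : nat) :
  0 < l -> 0 < (gegenbauer l n).[1].
Proof.
move=> l0; elim: n => [|n IH]; first by rewrite hornerC ltr01.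
rewrite -(pmulr_rgt0 _ (ltr0Sn R n)) gegenbauer_at1S mulr_gt0//.
by rewrite ltr_pwDl ?mulr_gt0.
Qed.

Lemma Dpoly0 (R : realType) (l : R) : Dpoly l 0 = 1.
Proof.
by rewrite /Dpoly; case: ifP => //= _; rewrite hornerC invr1 scale1r.
Qed.

Lemma Dpoly1 (R : realType) (l : R) : Dpoly l 1 = 'X.
Proof.
rewrite /Dpoly; case: ifPn => //= l0.
rewrite hornerZ hornerX mulr1 scalerA mulVf ?scale1r//.
by rewrite mulf_neq0 ?pnatr_eq0.
Qed.

(** Dividing the Gegenbauer recurrence by [C_(n+2)(1)] and evaluating the ratios by
    [gegenbauer_at1S] gives coefficients that at [l = 0] are [n + 1] times the Chebyshev ones. One
    recurrence thus serves both families, and later facts on [Dpoly] need no case split. *)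
Lemma Dpoly_rec (R : realType) (l : R) (n : nat) : 0 <= l ->
  (n%:R + 2 * l + 1) *: Dpoly l n.+2 =
  (2 * (n%:R + l + 1)) *: ('X * Dpoly l n.+1) - n.+1%:R *: Dpoly l n.
Proof.
move=> l_ge0; rewrite /Dpoly; case: ifPn => [/eqP -> /=|l0].
  by rewrite -!mul_polyC; ring.
have lp : 0 < l by rewrite lt_def l0.
set c := fun k => (gegenbauer l k).[1].
have c0 k : c k != 0 by rewrite gt_eqF// gegenbauer_at1_gt0.
have e1 := gegenbauer_at1S l n; have e2 := gegenbauer_at1S l n.+1.
rewrite -/(c n) -/(c n.+1) -/(c n.+2) in e1 e2 *.
have n2 : n.+2%:R != 0 :> R by rewrite pnatr_eq0.
have -> : n%:R + 2 * l + 1 = n.+2%:R * c n.+2 / c n.+1.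
  by rewrite e2 mulfK//; ring.
have -> : n.+1%:R *: ((c n)^-1 *: gegenbauer l n) =
    ((2 * l + n%:R) / c n.+1) *: gegenbauer l n.
  rewrite scalerA; congr (_ *: _); apply: (mulIf (c0 n)); rewrite mulfVK//.
  by apply: (mulIf (c0 n.+1)); rewrite e1 mulrAC mulfVK.
rewrite gegenbauerSS !scalerA.
have -> : n.+2%:R * c n.+2 / c n.+1 / c n.+2 / n.+2%:R = (c n.+1)^-1.
  by field; rewrite -natrD n2 !c0.
rewrite scalerBr !scalerA -(scalerAr _ 'X) scalerA.
by congr (_ *: _ - _ *: _); field; rewrite c0.
Qed.

Lemma Dpoly_at1 (R : realType) (l : R) (n : nat) : 0 <= l ->
  (Dpoly l n).[1] = 1.
Proof.
move=> l0; elim/nat_ind2: n => [||n IH IH1].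
- by rewrite Dpoly0 hornerC.
- by rewrite Dpoly1 hornerX.
have e0 : n%:R + 2 * l + 1 != 0.
  by rewrite gt_eqF// ltr_wpDl// addr_ge0// mulr_ge0.
have /(congr1 (horner^~ 1)) := Dpoly_rec n l0.
rewrite hornerD hornerN !hornerZ hornerM hornerX IH IH1 !mulr1 => e.
by apply: (mulfI e0); rewrite e; ring.
Qed.

(** The two relations are proved together: the second at [n + 1] is the first at [n] rewritten by
    the recurrence, and the first at [n + 1] follows from both at [n] by differentiating the
    recurrence. *)
Lemma deriv_Dpoly (R : realType) (l : R) (n : nat) : 0 <= l ->
  (1 - 'X^2) * (Dpoly l n.+1)^`() =
    n.+1%:R *: (Dpoly l n - 'X * Dpoly l n.+1) /\
  (1 - 'X^2) * (Dpoly l n)^`() =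
    (n%:R + 2 * l) *: ('X * Dpoly l n - Dpoly l n.+1).
Proof.
move=> l0; elim: n => [|n [IH1 IH2]].
  rewrite Dpoly0 Dpoly1 derivX.
  have -> : (1 : {poly R})^`() = 0 by rewrite -polyC1 derivC.
  by rewrite -!mul_polyC; split; ring.
have e0 : n%:R + 2 * l + 1 != 0.
  by rewrite gt_eqF// ltr_wpDl// addr_ge0// mulr_ge0.
have rec := Dpoly_rec n l0.
split; last first.
  rewrite IH1.
  transitivity ((n%:R + 2 * l + 1) *: ('X * Dpoly l n.+1) -
     (n%:R + 2 * l + 1) *: Dpoly l n.+2).
    by rewrite rec -!mul_polyC; ring.
  by rewrite -!mul_polyC; ring.
apply: (@scalerI _ _ _ e0).
have /(congr1 deriv) := rec.
rewrite !(derivZ, derivB, derivM, derivX) => drec.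
rewrite scalerAr drec.
transitivity ((2 * (n%:R + l + 1)) *:
   ((1 - 'X^2) * Dpoly l n.+1 + 'X * ((1 - 'X^2) * (Dpoly l n.+1)^`()))
   - n.+1%:R *: ((1 - 'X^2) * (Dpoly l n)^`())).
  by rewrite -!mul_polyC; ring.
rewrite IH1 IH2.
transitivity (n.+2%:R *: ((n%:R + 2 * l + 1) *: Dpoly l n.+1
   - 'X * ((n%:R + 2 * l + 1) *: Dpoly l n.+2))); last first.
  by rewrite -!mul_polyC; ring.
by rewrite rec -!mul_polyC; ring.
Qed.

Lemma Dpoly_ode (R : realType) (l : R) (n : nat) : 0 <= l ->
  (1 - 'X^2) * (Dpoly l n)^`()^`() - (2 * l + 1) *: ('X * (Dpoly l n)^`())
  = - (n%:R * (n%:R + 2 * l)) *: Dpoly l n.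
Proof.
move=> l0.
have [dA dB] := deriv_Dpoly n l0.
have X2 : (1 - 'X^2 : {poly R}) != 0.
  by rewrite -(size_poly_eq0) -opprB size_polyN size_XnsubC.
(* After multiplication by [1 - X^2], the derivative of the second relation supplies the
   second-order term, and both relations eliminate the remaining first derivatives. *)
apply: (mulfI X2).
have /(congr1 deriv) := dB.
rewrite !(derivZ, derivB, derivM, derivX, derivXn).
rewrite -[in 1^`()]polyC1 derivC => d2.
transitivity ((1 - 'X^2) *
    ((0 - 'X *+ 2) * (Dpoly l n)^`() + (1 - 'X^2) * (Dpoly l n)^`()^`())
  - (2 * l - 1) *: ('X * ((1 - 'X^2) * (Dpoly l n)^`()))).
  by rewrite -!mul_polyC; ring.
rewrite d2.
transitivity ((n%:R + 2 * l) *: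
    ((1 - 'X^2) * Dpoly l n + 'X * ((1 - 'X^2) * (Dpoly l n)^`())
     - (1 - 'X^2) * (Dpoly l n.+1)^`())
  - (2 * l - 1) *: ('X * ((1 - 'X^2) * (Dpoly l n)^`()))).
  by rewrite -!mul_polyC; ring.
by rewrite dA dB -!mul_polyC; ring.
Qed.

Lemma size_Dpoly (R : realType) (l : R) (n : nat) : 0 <= l ->
  size (Dpoly l n) = n.+1.
Proof.
move=> l0; elim/nat_ind2: n => [||n IH IH1].
- by rewrite Dpoly0 size_poly1.
- by rewrite Dpoly1 size_polyX.
have e0 : n%:R + 2 * l + 1 != 0.
  by rewrite gt_eqF// ltr_wpDl// addr_ge0// mulr_ge0.
have e1 : 2 * (n%:R + l + 1) != 0.
  by rewrite gt_eqF// mulr_gt0// ltr_wpDl// addr_ge0.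
have P0 : Dpoly l n.+1 != 0 by rewrite -size_poly_eq0 IH1.
have sX : size ((2 * (n%:R + l + 1)) *: ('X * Dpoly l n.+1)) = n.+3.
  by rewrite size_scale// mulrC size_mulX// IH1.
rewrite -(size_scale _ e0) Dpoly_rec// size_polyDl// size_polyN sX.
by rewrite size_scale ?pnatr_eq0// IH.
Qed.

Lemma Dpoly_span (R : realType) (l : R) (n : nat) (Q : {poly R}) : 0 <= l ->
  (size Q <= n)%N ->
  exists s : nat -> R, Q = \sum_(m < n) s m *: Dpoly l m.
Proof.
move=> l0; elim: n Q => [|n IH] Q sQ.
  exists (fun=> 0); rewrite big_ord0; apply/eqP.
  by rewrite -size_poly_eq0 -leqn0.
have lc : lead_coef (Dpoly l n) != 0.
  by rewrite lead_coef_eq0 -size_poly_eq0 size_Dpoly.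
(* [D_n] has degree exactly [n], so subtracting [c *: D_n] removes the top coefficient of [Q]. *)
pose c := Q`_n / lead_coef (Dpoly l n).
have [|s Qs] := IH (Q - c *: Dpoly l n).
  apply/leq_sizeP => j nj; rewrite coefB coefZ.
  move: nj; rewrite leq_eqVlt => /predU1P[<-|nj].
    rewrite /c lead_coefE size_Dpoly// mulfVK ?subrr//.
    by rewrite -[X in _`_X]/n.+1.-1 -(size_Dpoly n l0) -lead_coefE.
  by rewrite !nth_default ?mulr0 ?subrr// ?size_Dpoly// (leq_trans sQ).
exists (fun m => if m == n then c else s m).
rewrite big_ord_recr /= eqxx -[LHS](subrK (c *: Dpoly l n)) Qs; congr (_ + _).
by apply: eq_bigr => i _; rewrite ltn_eqF.
Qed.

Lemma gammac0 (R : realType) (l : R) : gammac l 0 = 1.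
Proof.
by rewrite /gammac; case: ifP => //= _; rewrite hornerC mulr1 mul0r addr0 invr1.
Qed.

Lemma gammac1 (R : realType) (l : R) : 0 <= l -> gammac l 1 = (2 * l + 2)^-1.
Proof.
move=> l0; rewrite /gammac; case: ifPn => [/eqP -> /=|ln0].
  by rewrite mulr0 add0r.
rewrite /= hornerZ hornerX; congr (_^-1); field.
by rewrite ln0.
Qed.

(** This is the recursion that the second moments of [D_n] will be shown to satisfy. It starts at
    index 1: at [l = 0] the step from 0 to 1 would read [0 = 0], so [gammac1] is a separate initial
    value. *)
Lemma gammacSS (R : realType) (l : R) (n : nat) : 0 <= l ->
  (n%:R + 2 * l + 1) * (n%:R + l + 2) * gammac l n.+2 =
  (n%:R + l + 1) * n.+2%:R * gammac l n.+1.
Proof.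
move=> l_ge0; rewrite /gammac; case: ifPn => [/eqP -> /=|l0]; first ring.
have lp : 0 < l by rewrite lt_def l0.
have e2 := gegenbauer_at1S l n.+1.
have c1 := gegenbauer_at1_gt0 n.+1 lp; have c2 := gegenbauer_at1_gt0 n.+2 lp.
move: e2 c1 c2; set a := (_ .[_]); set b := (_.[_]) => e2 b0 a0.
have -> : n%:R + 2 * l + 1 = n.+2%:R * a / b.
  by rewrite e2 mulfK ?gt_eqF//; ring.
field; rewrite l0 (gt_eqF a0) (gt_eqF b0) /=.
by rewrite !gt_eqF// ltr_pwDl ?addr_ge0.
Qed.

Lemma gammac_gt0 (R : realType) (l : R) (n : nat) : 0 <= l -> 0 < gammac l n.
Proof.
move=> l_ge0; rewrite /gammac; case: ifPn => [_|l0].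
  by case: ifP; rewrite ?ltr01// invr_gt0.
have lp : 0 < l by rewrite lt_def l0.
by rewrite invr_gt0 mulr_gt0 ?gegenbauer_at1_gt0// ltr_pwDl// divr_ge0.
Qed.

(** * Bounded measurable functions *)

(* Bounded measurable functions: integrable for every probability and closed
   under ring operations, so that linearity needs no integrability proofs. *)
Definition bmf d (T : measurableType d) (R : realType) (f : T -> R) : Prop :=
  measurable_fun setT f /\ exists M, forall x, `|f x| <= M.

Section bmf_theory.
Context d (T : measurableType d) (R : realType).
Implicit Types f g : T -> R.

Lemma bmf_cst (c : R) : bmf (fun _ : T => c).
Proof. by split; [exact: measurable_cst | exists `|c|]. Qed.

Lemma bmfD f g : bmf f -> bmf g -> bmf (fun x => f x + g x).
Proof.
move=> [mf [M hM]] [mg [N hN]]; split; first exact: measurable_funD.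
by exists (M + N) => x; rewrite (le_trans (ler_normD _ _))// lerD.
Qed.

Lemma bmfM f g : bmf f -> bmf g -> bmf (fun x => f x * g x).
Proof.
move=> [mf [M hM]] [mg [N hN]]; split; first exact: measurable_funM.
by exists (M * N) => x; rewrite normrM ler_pM.
Qed.

Lemma bmfN f : bmf f -> bmf (fun x => - f x).
Proof.
move=> bf; under eq_fun do rewrite -mulN1r.
by apply: bmfM => //; exact: bmf_cst.
Qed.

Lemma bmfB f g : bmf f -> bmf g -> bmf (fun x => f x - g x).
Proof. by move=> bf bg; exact: bmfD bf (bmfN bg). Qed.

Lemma bmfX f n : bmf f -> bmf (fun x => f x ^+ n).
Proof.
move=> bf; elim: n => [|n IH]; first exact: bmf_cst.
by under eq_fun do rewrite exprS; exact: bmfM.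
Qed.

Lemma bmf_sum (I : Type) (r : seq I) (Q : pred I) (F : I -> T -> R) :
  (forall i, bmf (F i)) -> bmf (fun x => \sum_(i <- r | Q i) F i x).
Proof.
move=> bF; elim: r => [|i r IH].
  by under eq_fun do rewrite big_nil; exact: bmf_cst.
under eq_fun do rewrite big_cons; case: (Q i) => //.
exact: bmfD (bF i) IH.
Qed.

Lemma bmf_horner (p : {poly R}) f : bmf f -> bmf (fun x => p.[f x]).
Proof.
move=> bf; under eq_fun do rewrite horner_coef.
by apply: bmf_sum => i; apply: bmfM; [exact: bmf_cst|exact: bmfX].
Qed.

Lemma bmf_indic (A : set T) : measurable A -> bmf (\1_A : T -> R).
Proof.
move=> mA; split; first exact: measurable_indic.
by exists 1 => x; rewrite indicE; case: (_ \in _); rewrite ?normr1 ?normr0.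
Qed.

Variable P : probability T R.

Lemma bmf_integrable f (A : set T) : measurable A -> bmf f ->
  P.-integrable A (EFin \o f).
Proof.
move=> mA [mf [M hM]]; apply: measurable_bounded_integrable => //.
- exact: le_lt_trans (probability_le1 P mA) (ltry 1).
- exact: measurable_funTS.
- exists M; split; first exact: num_real.
  by move=> N MN x _; exact: le_trans (hM x) (ltW MN).
Qed.

Lemma bmf_fin_num f (A : set T) : measurable A -> bmf f ->
  (\int[P]_(x in A) (f x)%:E)%E \is a fin_num.
Proof.
by move=> mA bf; apply: integrable_fin_num => //; exact: bmf_integrable.
Qed.

Lemma EFin_Rintegral f (A : set T) : measurable A -> bmf f ->
  (\int[P]_(x in A) f x)%:E = (\int[P]_(x in A) (f x)%:E)%E.
Proof. by move=> mA bf; rewrite /Rintegral fineK// bmf_fin_num. Qed.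

Lemma bmf_RintegralD f g : bmf f -> bmf g ->
  \int[P]_x (f x + g x) = \int[P]_x f x + \int[P]_x g x.
Proof. by move=> bf bg; rewrite RintegralD//; exact: bmf_integrable. Qed.

Lemma bmf_RintegralB f g : bmf f -> bmf g ->
  \int[P]_x (f x - g x) = \int[P]_x f x - \int[P]_x g x.
Proof. by move=> bf bg; rewrite RintegralB//; exact: bmf_integrable. Qed.

Lemma bmf_RintegralZ (c : R) f : bmf f ->
  \int[P]_x (c * f x) = c * \int[P]_x f x.
Proof. by move=> bf; rewrite RintegralZl//; exact: bmf_integrable. Qed.

Lemma Rintegral_prob_cst (c : R) : \int[P]_(_ in setT) c = c.
Proof. by rewrite Rintegral_cst//= probability_setT mulr1. Qed.

Lemma bmf_Rintegral_sum (I : Type) (r : seq I) (Q : pred I) (F : I -> T -> R) :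
  (forall i, bmf (F i)) ->
  \int[P]_x (\sum_(i <- r | Q i) F i x) = \sum_(i <- r | Q i) \int[P]_x F i x.
Proof.
move=> bF; elim: r => [|i r IH].
  by under eq_Rintegral do rewrite big_nil; rewrite Rintegral_prob_cst big_nil.
under eq_Rintegral do rewrite big_cons; rewrite big_cons; case: (Q i) => //.
by rewrite bmf_RintegralD ?IH//; exact: bmf_sum.
Qed.

End bmf_theory.

(** * Fubini, densities and measure-preserving maps for bounded measurable functions *)

Section fubini_bmf.
Context d1 d2 (T1 : measurableType d1) (T2 : measurableType d2) (R : realType).
Variables (P : probability T1 R) (Q : probability T2 R) (f : T1 * T2 -> R).
Hypothesis bf : bmf f.

Let f1 x : bmf (fun y => f (x, y)).
Proof.
have [mf [M hM]] := bf; split; last by exists M.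
exact: measurableT_comp mf (pair1_measurable x).
Qed.

Let f2 y : bmf (fun x => f (x, y)).
Proof.
have [mf [M hM]] := bf; split; last by exists M.
exact: measurableT_comp mf (pair2_measurable y).
Qed.

Let intf : (P \x Q)%E.-integrable setT (EFin \o f).
Proof.
have [mf [M hM]] := bf.
apply/integrable12ltyP; first exact/measurable_EFinP.
apply: (@le_lt_trans _ _ (\int[P]_x `|M|%:E)%E); last first.
  by rewrite integral_cst//= probability_setT mule1 ltry.
apply: ge0_le_integral => //.
- by move=> x _; exact: integral_ge0.
- apply: (measurable_fun_fubini_tonelli_F (fun z => `|(f z)%:E|)%E) => //.
  by apply: measurableT_comp => //; exact/measurable_EFinP.
move=> x _; rewrite -[leRHS]mule1 -(probability_setT Q) -integral_cst//.
apply: ge0_le_integral => //.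
- apply: measurableT_comp => //; apply/measurable_EFinP.
  by have [] := f1 x.
- by move=> y _ /=; rewrite lee_fin (le_trans (hM _))// ler_norm.
Qed.

Lemma bmf_Rintegral_swap :
  \int[P]_x \int[Q]_y f (x, y) = \int[Q]_y \int[P]_x f (x, y).
Proof.
rewrite /Rintegral; congr fine.
under eq_integral do rewrite fineK ?bmf_fin_num//.
under [RHS]eq_integral do rewrite fineK ?bmf_fin_num//.
exact: (Fubini intf).
Qed.

Lemma bmf_Rintegral : bmf (fun x => \int[Q]_y f (x, y)).
Proof.
have [mf [M hM]] := bf.
split.
  apply/measurable_EFinP.
  have -> : EFin \o (fun x => \int[Q]_y f (x, y)) =
      fun x => (\int[Q]_y (f (x, y))%:E)%E.
    by apply/funext => x /=; rewrite EFin_Rintegral.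
  exact: measurable_fubini_F intf.
exists M => x; rewrite (le_trans (le_normr_Rintegral _ _))//.
  exact: bmf_integrable.
rewrite -[leRHS](Rintegral_prob_cst Q); apply: le_Rintegral => //.
- apply/integrable_norm; exact: bmf_integrable.
- apply: bmf_integrable => //; exact: bmf_cst.
Qed.

End fubini_bmf.

Lemma bmf_fst d1 d2 (T1 : measurableType d1) (T2 : measurableType d2)
    (R : realType) (f : T1 -> R) : bmf f -> bmf (fun z : T1 * T2 => f z.1).
Proof.
move=> [mf [M hM]]; split; last by exists M => -[].
exact: measurableT_comp mf measurable_fst.
Qed.

Lemma bmf_snd d1 d2 (T1 : measurableType d1) (T2 : measurableType d2)
    (R : realType) (f : T2 -> R) : bmf f -> bmf (fun z : T1 * T2 => f z.2).
Proof.
move=> [mf [M hM]]; split; last by exists M => -[].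
exact: measurableT_comp mf measurable_snd.
Qed.

(** The left integral is against a bare set function, which is first packed as a finite measure
    [nu]. Its Radon-Nikodym derivative agrees with [g] almost everywhere, since both have the same
    integral over every measurable set; the change of variables then gives the claim. *)
Lemma integral_bmf_density d (T : measurableType d) (R : realType)
    (P : probability T R) (g f : T -> R) :
  bmf g -> (forall x, 0 <= g x) -> bmf f ->
  (\int[fun A => \int[P]_(x in A) (g x)%:E]_x (f x)%:E =
   \int[P]_x (f x * g x)%:E)%E.
Proof.
move=> bg g0 bf.
have mg := (measurable_EFinP _ _).2 bg.1.
have mf := (measurable_EFinP _ _).2 bf.1.
pose nu0 A := (\int[P]_(x in A) (g x)%:E)%E.
have nu00 : nu0 set0 = 0%E by exact: integral_set0.
have nu0_ge0 A : (0 <= nu0 A)%E.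
  by apply: integral_ge0 => x _; rewrite lee_fin.
have nu0_sigma : semi_sigma_additive nu0.
  by apply: semi_sigma_additive_nng_induced => // x; rewrite lee_fin.
pose H1 := isMeasure.Build _ _ _ nu0 nu00 nu0_ge0 nu0_sigma.
pose nu1 : {measure set T -> \bar R} := HB.pack nu0 H1.
have nu0_fin : fin_num_fun nu1 by move=> A mA; exact: bmf_fin_num.
pose H2 := Measure_isFinite.Build _ T R (Measure.sort nu1) nu0_fin.
pose nu : {finite_measure set T -> \bar R} :=
  HB.pack_for (FiniteMeasure.type T R) (Measure.sort nu1) H2.
rewrite -[LHS]/(\int[nu]_x (f x)%:E)%E.
have nuP : nu `<< P.
  apply/null_content_dominatesP => A mA PA.
  by apply: null_set_integral => //; exact: measurable_funTS.
have inuf : nu.-integrable setT (EFin \o f).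
  have [_ [M hM]] := bf; apply: measurable_bounded_integrable => //.
  - by rewrite ltey_eq fin_num_measure.
  - by case: bf.
  - exists M; split; first exact: num_real.
    by move=> N MN x _; exact: le_trans (hM x) (ltW MN).
rewrite -(Radon_Nikodym_change_of_variables nuP)//.
apply: ae_eq_integral => //.
- by apply: emeasurable_funM => //; apply: (measurable_int P).
- by apply/measurable_EFinP; exact: (bmfM bf bg).1.
rewrite (_ : (fun x => (f x * g x)%:E) = ((EFin \o f) \* (EFin \o g))%E)//.
apply: ae_eqe_mul2l.
apply: integral_ae_eq => //.
- by apply: Radon_Nikodym_integrable; exact: nuP.
- by move=> E _ mE; rewrite -Radon_Nikodym_integral//; exact: nuP.
Qed.

Lemma Rintegral_measure_preserving d (T : measurableType d) (R : realType)
    (P : probability T R) (phi : T -> T) (f : T -> R) :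
  measurable_fun setT phi ->
  (forall A, measurable A -> P (phi @^-1` A) = P A) -> bmf f ->
  \int[P]_x f (phi x) = \int[P]_x f x.
Proof.
move=> mphi hphi bf.
pose H := isMeasurableFun.Build _ _ _ _ _ mphi.
pose phi' : {mfun T >-> T} := HB.pack phi H.
have bfphi : bmf (fun x => f (phi x)).
  have [mf [M hM]] := bf; split; last by exists M.
  exact: measurableT_comp mf mphi.
rewrite /Rintegral; congr fine.
transitivity (\int[pushforward P phi']_x (f x)%:E)%E.
  rewrite integral_pushforward//=; first exact/measurable_EFinP/bf.1.
  by rewrite preimage_setT; exact: (bmf_integrable P measurableT bfphi).
by apply: eq_measure_integral => A mA _; exact: hphi.
Qed.

Ltac bmf_tac := repeat lazymatch goal with
  | |- bmf (fun _ => ?c) => apply: bmf_cst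
  | |- bmf (fun x => @?f x + @?g x) => apply: (@bmfD _ _ _ f g)
  | |- bmf (fun x => - @?f x) => apply: (@bmfN _ _ _ f)
  | |- bmf (fun x => @?f x * @?g x) => apply: (@bmfM _ _ _ f g)
  | |- bmf (fun x => @?f x ^+ ?n) => apply: (@bmfX _ _ _ f n)
  | |- bmf (fun x => ?p.[@?f x]) => apply: (@bmf_horner _ _ _ p f)
  | |- bmf _ => first [eassumption
      | match goal with H : forall _, bmf _ |- _ => exact: H end]
  end.

(** * Rotations of the sphere *)

(** Convergence is coordinatewise: each coordinate of [u *m Q] is a finite sum of continuous
    functions, and [filter_forall] intersects the finitely many neighbourhoods. *)
Lemma mulmxr_continuous (R : realType) (n : nat) (Q : 'M[R]_n) :
  continuous (fun u : 'rV[R]_n => u *m Q).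
Proof.
move=> u A [P hP PA].
have FF : Filter (nbhs u) by exact: nbhs_filter.
have cj j : (fun v : 'rV[R]_n => (v *m Q) 0 j) @ u --> (u *m Q) 0 j.
  rewrite mxE (_ : (fun v => _) = fun v : 'rV[R]_n => \sum_k v 0 k * Q k j).
    apply: (@cvg_big _ _ +%R 0 xpredT (@add_continuous _) _ (nbhs u)) => k _.
    apply: (@cvgM _ _ _ _ (fun v : 'rV[R]_n => v 0 k) (cst (Q k j))).
      exact: coord_continuous.
    exact: cvg_cst.
  by apply/funext => v; rewrite mxE.
have := @filter_forall _ _ (fun j (v : 'rV[R]_n) => P 0 j ((v *m Q) 0 j)) _ FF
  (fun j => cj j _ (hP 0 j)).
by apply: filterS => v hv; apply: PA => i j; rewrite (ord1 i).
Qed.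

Section dotp_theory.
Context (R : realType) (n : nat).
Implicit Types (u v w : 'rV[R]_n) (Q : 'M[R]_n).

Lemma dotpE u v : dotp u v = (u *m v^T) 0 0.
Proof. by rewrite mxE; apply: eq_bigr => i _; rewrite mxE. Qed.

Lemma dotpC u v : dotp u v = dotp v u.
Proof. by apply: eq_bigr => i _; rewrite mulrC. Qed.

Lemma dotpDl u v w : dotp (u + v) w = dotp u w + dotp v w.
Proof. by rewrite !dotpE mulmxDl mxE. Qed.

Lemma dotpZl (a : R) u v : dotp (a *: u) v = a * dotp u v.
Proof. by rewrite !dotpE -scalemxAl mxE. Qed.

Lemma dotpDr u v w : dotp w (u + v) = dotp w u + dotp w v.
Proof. by rewrite dotpC dotpDl !(dotpC w). Qed.

Lemma dotpZr (a : R) u v : dotp u (a *: v) = a * dotp u v.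
Proof. by rewrite dotpC dotpZl dotpC. Qed.

Lemma dotp_mulmx u v Q : dotp (u *m Q) v = dotp u (v *m Q^T).
Proof. by rewrite !dotpE trmx_mul trmxK mulmxA. Qed.

Lemma dotp_delta u j : dotp u (delta_mx 0 j) = u 0 j.
Proof.
rewrite /dotp (bigD1 j)//= big1 => [|i ij]; rewrite mxE ?eqxx ?mulr1 ?addr0//.
by rewrite (negbTE ij) andbF mulr0.
Qed.

End dotp_theory.

Section sphere_theory.
Context (R : realType) (d : nat).
Implicit Types x y : sphere R d.

Lemma unit_sphereE (u : 'rV[R]_d.+1) : unit_sphere u <-> dotp u u = 1.
Proof.
have u0 : 0 <= dotp u u by apply: sumr_ge0 => i _; rewrite -expr2 sqr_ge0.
rewrite /unit_sphere /= /enorm; split=> [/(congr1 (fun z => z ^+ 2))|->].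
  by rewrite sqr_sqrtr// expr1n.
by rewrite sqrtr1.
Qed.

Lemma dotp_svec x : dotp (svec x) (svec x) = 1.
Proof. by apply/unit_sphereE; exact: set_valP. Qed.

Lemma svec_inj : injective (@svec R d).
Proof. by move=> x y /val_inj. Qed.

Definition to_sphere (u : 'rV[R]_d.+1) (u1 : dotp u u = 1) : sphere R d :=
  SigSub (mem_set ((unit_sphereE u).2 u1)).

Lemma measurable_svec j : measurable_fun setT (fun x => svec x 0 j).
Proof.
apply: (measurability _ (RGenOpens.measurableE R)).
move=> _ [_ [a [b ->] <-]]; rewrite setTI; apply: sub_sigma_algebra.
have : continuous (fun x : set_type (@unit_sphere R d) => svec x 0 j).
  move=> x; apply: (@continuous_comp _ _ _ (@set_val _ (@unit_sphere R d))
    (fun u : 'rV[R]_d.+1 => u 0 j)); first exact: initial_continuous.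
  exact: coord_continuous.
by move/continuousP; apply; exact: interval_open.
Qed.

Lemma bmf_svec j : bmf (fun x => svec x 0 j).
Proof.
split; first exact: measurable_svec.
exists 1 => x; rewrite -(@ler_pXn2r _ 2)// ?nnegrE//.
rewrite expr1n real_normK ?num_real//.
rewrite -(dotp_svec x) /dotp (bigD1 j)//= -expr2 lerDl.
by apply: sumr_ge0 => i _; rewrite -expr2 sqr_ge0.
Qed.

Lemma bmf_dotp (u : 'rV[R]_d.+1) : bmf (fun x => dotp u (svec x)).
Proof.
by apply: bmf_sum => i; apply: bmfM; [exact: bmf_cst|exact: bmf_svec].
Qed.

Lemma bmf_dotp2 :
  bmf (fun z : sphere R d * sphere R d => dotp (svec z.1) (svec z.2)).
Proof.
apply: bmf_sum => i; have [mi [M hM]] := bmf_svec i.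
apply: bmfM; split; [|by exists M => -[]| |by exists M => -[]].
- exact: measurableT_comp mi measurable_fst.
- exact: measurableT_comp mi measurable_snd.
Qed.

Section rotation.
Variables (Q : 'M[R]_d.+1) (hQ : Q *m Q^T = 1%:M).

Lemma dotp_srot u v : dotp (u *m Q) (v *m Q) = dotp u v.
Proof. by rewrite dotp_mulmx -mulmxA hQ mulmx1. Qed.

Definition srot x : sphere R d :=
  to_sphere (etrans (dotp_srot (svec x) (svec x)) (dotp_svec x)).

Lemma svec_srot x : svec (srot x) = svec x *m Q.
Proof. by []. Qed.

Lemma measurable_srot : measurable_fun setT srot.
Proof.
apply: (@measurability _ _ (sphere R d) (sphere R d) setT srot
  (@open (set_type (@unit_sphere R d))) erefl).
move=> _ [_ [V oV <-] <-]; rewrite setTI; apply: sub_sigma_algebra.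
have : continuous (srot : set_type (@unit_sphere R d) ->
                          set_type (@unit_sphere R d)).
  apply: continuous_comp_initial => x.
  apply: (@continuous_comp _ _ _ (@set_val _ (@unit_sphere R d))
    (fun u : 'rV[R]_d.+1 => u *m Q)); first exact: initial_continuous.
  exact: mulmxr_continuous.
by move/continuousP; apply; exists V.
Qed.

(** [is_unif] speaks of images; the preimage under [srot] is the image under the inverse [Q^T],
    which is orthogonal as well. *)
Lemma pushforward_srot (unif : probability (sphere R d) R) : is_unif unif ->
  forall A, measurable A -> unif (srot @^-1` A) = unif A.
Proof.
move=> hu A mA.
have hQT : Q^T *m Q^T^T = 1%:M by rewrite trmxK; exact: mulmx1C.
rewrite -[RHS](hu _ hQT A mA); congr (unif _); apply/seteqP; split => x /=.
  move=> Ax; exists (srot x) => //.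
  by rewrite svec_srot -mulmxA hQ mulmx1.
move=> [a Aa xa]; suff -> : srot x = a by [].
by apply: svec_inj; rewrite svec_srot xa -mulmxA (mulmx1C hQ) mulmx1.
Qed.

Lemma Rintegral_srot (unif : probability (sphere R d) R) (f : sphere R d -> R) :
  is_unif unif -> bmf f ->
  \int[unif]_x f (srot x) = \int[unif]_x f x.
Proof.
move=> hu bf; apply: Rintegral_measure_preserving => //.
  exact: measurable_srot.
exact: pushforward_srot.
Qed.

End rotation.

End sphere_theory.

(** * Polynomial identities and polynomial-valued random variables *)

Lemma horner_eq0 (R : realType) (p : {poly R}) :
  (forall t, p.[t] = 0) -> p = 0.
Proof.
move=> p0; apply/eqP/negPn/negP => pn0.
(* These would be [size p] distinct roots, one more than a nonzero [p] can have. *)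
pose rs : seq R := [seq i%:R | i <- iota 0 (size p)].
have := max_poly_roots pn0 (rs := rs); rewrite size_map size_iota ltnn.
suff [-> ->] : all (root p) rs /\ uniq rs by move=> /(_ isT isT).
split; first by apply/allP => x _; apply/eqP.
rewrite map_inj_uniq ?iota_uniq// => i j /eqP.
by rewrite eqr_nat => /eqP.
Qed.

(* Families of polynomials whose coefficients are bounded measurable and whose
   degrees are uniformly bounded: they can be integrated coefficientwise. *)
Definition bmf_poly d (T : measurableType d) (R : realType)
    (F : T -> {poly R}) : Prop :=
  (forall i, bmf (fun x => (F x)`_i)) /\
  exists N, forall x, (size (F x) <= N)%N.

Section bmf_poly_theory.
Context d (T : measurableType d) (R : realType).
Implicit Types F G : T -> {poly R}.

Lemma bmf_poly_cst (p : {poly R}) : bmf_poly (fun _ : T => p).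
Proof. by split; [move=> i; exact: bmf_cst|by exists (size p)]. Qed.

Lemma bmf_polyC (f : T -> R) : bmf f -> bmf_poly (fun x => (f x)%:P).
Proof.
move=> bf; split; last by exists 1%N => x; exact: size_polyC_leq1.
by move=> [|i]; under eq_fun do rewrite coefC /=; [|exact: bmf_cst].
Qed.

Lemma bmf_polyD F G : bmf_poly F -> bmf_poly G -> bmf_poly (fun x => F x + G x).
Proof.
move=> [bF [M hM]] [bG [N hN]]; split.
  by move=> i; under eq_fun do rewrite coefD; exact: bmfD.
exists (maxn M N) => x; rewrite (leq_trans (size_polyD _ _))// geq_max.
by rewrite !leq_max hM hN orbT.
Qed.

Lemma bmf_polyM F G : bmf_poly F -> bmf_poly G -> bmf_poly (fun x => F x * G x).
Proof.
move=> [bF [M hM]] [bG [N hN]]; split.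
  move=> i; under eq_fun do rewrite coefM.
  by apply: bmf_sum => j; exact: bmfM.
exists (M + N)%N => x; rewrite (leq_trans (size_polyMleq _ _))//.
by rewrite (leq_trans (leq_pred _))// leq_add.
Qed.

Lemma bmf_polyX F n : bmf_poly F -> bmf_poly (fun x => F x ^+ n).
Proof.
move=> bF; elim: n => [|n IH]; first exact: (bmf_poly_cst 1).
by under eq_fun do rewrite exprS; exact: bmf_polyM.
Qed.

(** Replaces differentiation under the integral sign: [q] can be identified through its values, and
    its coefficient at 1 then gives the integral of the derivatives at 0. *)
Lemma Rintegral_bmf_poly (P : probability T R) F : bmf_poly F ->
  exists q : {poly R}, (forall t, q.[t] = \int[P]_x (F x).[t]) /\
                       (forall i, q`_i = \int[P]_x (F x)`_i).
Proof.
move=> [bF [N hN]]; exists (\poly_(i < N) \int[P]_x (F x)`_i); split=> [t|i].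
  rewrite horner_poly.
  under [RHS]eq_Rintegral do rewrite (horner_coef_wide _ (hN _)).
  rewrite bmf_Rintegral_sum; last first.
    by move=> i; apply: bmfM => //; exact: bmf_cst.
  by apply: eq_bigr => i _; rewrite RintegralZr//; exact: bmf_integrable.
rewrite coef_poly; case: ltnP => // Ni.
under eq_Rintegral do rewrite (nth_default _ (leq_trans (hN _) Ni)).
by rewrite Rintegral_prob_cst.
Qed.

End bmf_poly_theory.

(** * Householder reflections *)

Section reflection.
Context (R : realType) (n : nat).
Implicit Types u v w y : 'rV[R]_n.

Definition refl v : 'M[R]_n := 1%:M - (2 / dotp v v) *: (v^T *m v).

Lemma dotp_refl v u y :
  dotp y (u *m refl v) = dotp y u - 2 * dotp u v * dotp y v / dotp v v.
Proof.
have -> : u *m refl v = u + (- (2 * dotp u v / dotp v v)) *: v.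
  rewrite /refl mulmxBr mulmx1 -scalemxAr mulmxA scaleNr; congr (_ - _).
  rewrite [u *m v^T]mx11_scalar -dotpE mul_scalar_mx scalerA; congr (_ *: _).
  by rewrite mulrAC.
by rewrite dotpDr dotpZr; ring.
Qed.

(** The matrix [A = v^T v] is symmetric with [A^2 = (v . v) A], and [c = 2 / (v . v)] satisfies
    [c^2 (v . v) = 2 c]; hence [1 - c A] is symmetric with square 1. *)
Lemma refl_orthogonal v : dotp v v != 0 -> refl v *m (refl v)^T = 1%:M.
Proof.
move=> v0; rewrite /refl; set A := v^T *m v; set c := 2 / dotp v v.
have AT : A^T = A by rewrite /A trmx_mul trmxK.
have AA : A *m A = dotp v v *: A.
  rewrite /A mulmxA -(mulmxA _ v) (mx11_scalar (v *m v^T)) -dotpE.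
  by rewrite mul_mx_scalar -scalemxAl.
have cc : c * c * dotp v v = c + c by rewrite /c; field.
have -> : (1%:M - c *: A)^T = 1%:M - c *: A.
  apply/matrixP => i j; have /matrixP/(_ j i) := AT.
  by rewrite !mxE => ->; rewrite (eq_sym j).
rewrite mulmxBl mul1mx mulmxBr mulmx1.
rewrite -scalemxAl -scalemxAr AA !scalerA.
rewrite cc; clearbody A c; rewrite scalerDl; set X := c *: A.
by rewrite (_ : X - (X + X) = - X) ?opprK ?subrK// opprD addrA subrr add0r.
Qed.

End reflection.

(** * Infinitesimal rotations *)

Section rotation_identity.
Context (R : realType) (d : nat) (unif : probability (sphere R d) R).
Hypothesis hunif : is_unif unif.
Implicit Types (e z y : 'rV[R]_d.+1) (x : sphere R d).

(** [F] lives on the ambient space so that the lemma can be iterated: the first component is the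
    hypothesis needed to apply it again to [fun u => F (u *m refl v)]. *)
Lemma Rintegral_refl (v : 'rV[R]_d.+1) (F : 'rV[R]_d.+1 -> R) :
  dotp v v != 0 -> bmf (fun x => F (svec x)) ->
  bmf (fun x => F (svec x *m refl v)) /\
  \int[unif]_x F (svec x *m refl v) = \int[unif]_x F (svec x).
Proof.
move=> /refl_orthogonal hv bF; split.
  have [mF [M hM]] := bF; split; last first.
    by exists M => x; have := hM (srot hv x); rewrite svec_srot.
  exact: measurableT_comp mF (measurable_srot hv).
exact: (Rintegral_srot hv hunif bF).
Qed.

(* With v = e + t z and e a unit vector, [rot_form e z y x] is the polynomial
   in t equal to (v . v) times the dot product of y with the image of x under
   the reflections in e and then in v. The factor v . v clears the denominator
   of the second reflection, and at t = 0 the two reflections cancel. *)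
Definition rot_form e z y x : {poly R} :=
  let y' := dotp y (svec x) - 2 * dotp (svec x) e * dotp y e in
  (1%:P + (2 * dotp z e) *: 'X + dotp z z *: 'X^2) * y'%:P
  - 2 *: (((- dotp e (svec x))%:P
           + (dotp z (svec x) - 2 * dotp (svec x) e * dotp z e) *: 'X)
          * ((dotp y e)%:P + dotp y z *: 'X)).

Lemma bmf_rot_form e z y : bmf_poly (rot_form e z y).
Proof.
have bu u : bmf (fun x => dotp u (svec x)) by exact: bmf_dotp.
have bv u : bmf (fun x => dotp (svec x) u).
  by under eq_fun do rewrite dotpC; exact: bu.
rewrite /rot_form /=.
under eq_fun do rewrite -!mul_polyC.
have bc (p : {poly R}) : bmf_poly (fun _ : sphere R d => p).
  exact: bmf_poly_cst.
have bc' (c : R) : bmf (fun _ : sphere R d => c) by exact: bmf_cst.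
have by' u : bmf (fun x => dotp u (svec x) - 2 * dotp (svec x) e * dotp u e).
  by apply: bmfB => //; do 2 apply: bmfM => //.
apply: bmf_polyD; first by apply: bmf_polyM => //; exact: bmf_polyC.
under eq_fun do rewrite -mulN1r.
do 2 apply: bmf_polyM => //.
apply: bmf_polyM => //; apply: bmf_polyD.
  by apply: bmf_polyC; exact: bmfN.
by apply: bmf_polyM => //; exact: bmf_polyC.
Qed.

Lemma horner_rot_form e z y x (t : R) : dotp e e = 1 ->
  let v := e + t *: z in dotp v v != 0 ->
  (rot_form e z y x).[t] = dotp v v * dotp y (svec x *m refl e *m refl v).
Proof.
move=> e1 v v0; rewrite dotp_refl.
have -> : dotp v v * (dotp y (svec x *m refl e) -
     2 * dotp (svec x *m refl e) v * dotp y v / dotp v v) =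
   dotp v v * dotp y (svec x *m refl e)
     - 2 * dotp (svec x *m refl e) v * dotp y v by field.
rewrite (dotpC (_ *m _) v) !dotp_refl e1 divr1.
rewrite {v0}/v /rot_form /= !(dotpDl, dotpDr, dotpZl, dotpZr) e1.
rewrite !(hornerD, hornerN, hornerM, hornerZ, hornerX, hornerXn, hornerC).
rewrite (dotpC (svec x) e) (dotpC e z) divr1.
ring.
Qed.

Lemma rot_form_at0 e z y x : dotp e e = 1 ->
  (rot_form e z y x).[0] = dotp y (svec x).
Proof.
move=> e1; rewrite /rot_form.
rewrite !(hornerD, hornerN, hornerM, hornerZ, hornerX, hornerXn, hornerC).
by rewrite (dotpC (svec x) e); ring.
Qed.

(** The first summand is the contribution of the factor [v . v], whose derivative at 0 is [2 z . e];
    the second is twice the infinitesimal rotation in the plane of [e] and [z]. *)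
Lemma deriv_rot_form_at0 e z y x : dotp e e = 1 ->
  (rot_form e z y x)^`().[0] = 2 * dotp z e * dotp y (svec x)
    + 2 * (dotp e (svec x) * dotp y z - dotp z (svec x) * dotp y e).
Proof.
move=> e1; rewrite /rot_form.
rewrite !(derivB, derivD, derivM, derivZ, derivC, derivX, derivXn).
rewrite !(hornerD, hornerN, hornerM, hornerZ, hornerX, hornerXn).
rewrite !(hornerC, horner0, hornerMn).
by rewrite (dotpC (svec x) e); ring.
Qed.

Lemma coef1_deriv (p : {poly R}) : p`_1 = p^`().[0].
Proof. by rewrite horner_coef0 coef_deriv. Qed.

(* The infinitesimal rotation in the plane of e and z integrates to 0: this is
   the coefficient of t in the invariance of the integral of a product of
   linear forms under the two reflections behind [rot_form]. *)
Lemma Rintegral_rot_monomial e z y0 y1 y2 (a b : nat) : dotp e e = 1 ->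
  let p y x := dotp y (svec x) in
  let D y x := p e x * dotp y z - p z x * dotp y e in
  \int[unif]_x (D y0 x * p y1 x ^+ a * p y2 x ^+ b
    + a%:R * p y0 x * D y1 x * p y1 x ^+ a.-1 * p y2 x ^+ b
    + b%:R * p y0 x * D y2 x * p y1 x ^+ a * p y2 x ^+ b.-1) = 0.
Proof.
move=> e1 p D.
have bp y : bmf (p y) by exact: bmf_dotp.
pose F x := rot_form e z y0 x * rot_form e z y1 x ^+ a * rot_form e z y2 x ^+ b.
have bF : bmf_poly F.
  by apply: bmf_polyM; [apply: bmf_polyM|]; try apply: bmf_polyX;
    exact: bmf_rot_form.
have [q [q_horner q_coef]] := Rintegral_bmf_poly unif bF.
pose V := 1%:P + (2 * dotp z e) *: 'X + dotp z z *: 'X^2.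
pose G u := dotp y0 u * dotp y1 u ^+ a * dotp y2 u ^+ b.
have bG : bmf (fun x => G (svec x)).
  exact: bmfM (bmfM (bp y0) (bmfX a (bp y1))) (bmfX b (bp y2)).
pose c := \int[unif]_x G (svec x).
have V0 : V.[0] = 1.
  by rewrite /V !(hornerD, hornerZ, hornerX, hornerXn, hornerC); ring.
(* [V] is [v . v] as a polynomial in [t]. Each of the [a + b + 1] linear forms contributes one
   factor [V], and invariance under both reflections leaves the constant [c]. *)
have qV : q = c *: V ^+ (a + b).+1.
  have Vn0 : V != 0.
    apply/eqP => /(congr1 (horner^~ 0)).
    by rewrite V0 horner0; exact/eqP/oner_neq0.
  (* The reflection in [v] requires [V.[t] != 0]; multiplying the identity by [V] makes it trivial
     at the zeros of [V]. *)
  apply: (mulIf Vn0); apply/eqP; rewrite -subr_eq0; apply/eqP.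
  apply: horner_eq0 => t; rewrite -mulrBl hornerM.
  have [->|Vt0] := eqVneq V.[t] 0; first by rewrite mulr0.
  have Vt : V.[t] = dotp (e + t *: z) (e + t *: z).
    rewrite /V !(hornerD, hornerZ, hornerX, hornerXn, hornerC).
    by rewrite !(dotpDl, dotpDr, dotpZl, dotpZr) e1 (dotpC e z); ring.
  rewrite hornerD hornerN q_horner hornerZ horner_exp.
  suff -> : \int[unif]_x (F x).[t] = V.[t] ^+ (a + b).+1 * c by ring.
  rewrite Vt in Vt0 *.
  set v := e + t *: z in Vt0 *.
  have Fx x : (F x).[t] =
      dotp v v ^+ (a + b).+1 * G (svec x *m refl e *m refl v).
    rewrite /F !hornerM !horner_exp !horner_rot_form// -/v !exprMn /G.
    by rewrite exprS exprD; ring.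
  under eq_Rintegral do rewrite Fx.
  have [bG1 G1] := Rintegral_refl Vt0 bG.
  have e0 : dotp e e != 0 by rewrite e1 oner_neq0.
  have [bG2 G2] := @Rintegral_refl e (fun u => G (u *m refl v)) e0 bG1.
  by rewrite bmf_RintegralZ// G2 G1.
(* Comparing coefficients of [t]: the derivative of [V ^+ (a + b).+1] cancels the contributions of
   the factors [v . v], so only the rotation terms remain. *)
have := q_coef 1%N.
rewrite qV coefZ coef1_deriv deriv_exp.
rewrite hornerMn hornerM horner_exp V0 expr1n mulr1.
have -> : V^`().[0] = 2 * dotp z e.
  rewrite /V !(derivD, derivZ, derivC, derivX, derivXn).
  rewrite !(hornerD, hornerZ, hornerX, hornerXn, hornerC, hornerMn, horner0).
  by ring.
have dF x : (F x)`_1 = 2 * dotp z e * (a + b).+1%:R * G (svec x) +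
   2 * (D y0 x * p y1 x ^+ a * p y2 x ^+ b
    + a%:R * p y0 x * D y1 x * p y1 x ^+ a.-1 * p y2 x ^+ b
    + b%:R * p y0 x * D y2 x * p y1 x ^+ a * p y2 x ^+ b.-1).
  rewrite coef1_deriv /F.
  move: (rot_form_at0 z y0 x e1) (deriv_rot_form_at0 z y0 x e1).
  move: (rot_form_at0 z y1 x e1) (deriv_rot_form_at0 z y1 x e1).
  move: (rot_form_at0 z y2 x e1) (deriv_rot_form_at0 z y2 x e1).
  move: (rot_form e z y0 x) (rot_form e z y1 x) (rot_form e z y2 x).
  move=> f0 f1 f2 h2 d2 h1 d1 h0 d0.
  rewrite !derivM !deriv_exp !(hornerD, hornerM, hornerMn, horner_exp).
  rewrite h0 h1 h2 d0 d1 d2 /G -!/(p _ _) -!/(D _ _).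
  by case: (a) (b) => [|a'] [|b'] /=; rewrite ?exprS; ring.
under eq_Rintegral do rewrite dF.
have bD y : bmf (D y).
  by apply: bmfB; apply: bmfM => //; exact: bmf_cst.
rewrite bmf_RintegralD; last 2 first.
- by apply: bmfM => //; exact: bmf_cst.
- apply: bmfM; first exact: bmf_cst.
  by bmf_tac.
rewrite bmf_RintegralZ// -/c bmf_RintegralZ; last first.
  by bmf_tac.
set I := Rintegral _ _ _ => h.
have : 2 * I = 0.
  move: h; rewrite -[in X in X = _]mulr_natr => h.
  apply: (@addrI _ (2 * dotp z e * (a + b).+1%:R * c)); rewrite addr0 -h; ring.
by move/eqP; rewrite mulf_eq0 pnatr_eq0 /= => /eqP.
Qed.

End rotation_identity.

(** * Zonal functions *)

Lemma poly_linear_eq0 (R : realType) (L : {poly R} -> R) :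
  (forall c p q, L (c *: p + q) = c * L p + L q) ->
  (forall n, L 'X^n = 0) -> forall p, L p = 0.
Proof.
move=> Llin LX p; have L0 : L 0 = 0.
  have := Llin 1 0 0; rewrite scale1r addr0 mul1r.
  by move/(congr1 (fun x => x - L 0)); rewrite subrr addrK.
rewrite -[p]coefK poly_def; elim/big_ind: _ => // [q r q0 r0|i _].
  by rewrite -[q]scale1r Llin q0 r0 mulr0 addr0.
by rewrite -[_ *: _]addr0 Llin LX L0 mulr0 addr0.
Qed.

Section zonal.
Context (R : realType) (d : nat) (unif : probability (sphere R d) R).
Hypothesis hunif : is_unif unif.
Implicit Types (z y : 'rV[R]_d.+1) (x : sphere R d).

(* Summing the infinitesimal rotations in the planes (e_j, z) over j turns the
   vanishing above into the divergence theorem for the tangential projection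
   of z. *)
Lemma Rintegral_ibp_monomial z y (a b : nat) : dotp z z = 1 ->
  let u x := dotp z (svec x) in let w x := dotp y (svec x) in
  \int[unif]_x ((1 - u x ^+ 2) * (a%:R * u x ^+ a.-1) * w x ^+ b
    + (dotp z y - u x * w x) * u x ^+ a * (b%:R * w x ^+ b.-1)
    - d%:R * u x * u x ^+ a * w x ^+ b) = 0.
Proof.
move=> z1 u w.
pose e j : 'rV[R]_d.+1 := delta_mx 0 j.
have e1 j : dotp (e j) (e j) = 1 by rewrite dotp_delta mxE !eqxx.
pose p y x := dotp y (svec x).
have bp v : bmf (p v) by exact: bmf_dotp.
pose D j v x := p (e j) x * dotp v z - p z x * dotp v (e j).
have bD j v : bmf (D j v).
  by apply: bmfB; apply: bmfM => //; exact: bmf_cst.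
pose f j x := D j (e j) x * u x ^+ a * w x ^+ b
    + a%:R * p (e j) x * D j z x * u x ^+ a.-1 * w x ^+ b
    + b%:R * p (e j) x * D j y x * u x ^+ a * w x ^+ b.-1.
have bf j : bmf (f j).
  by rewrite /f; repeat (exact: bmf_cst || exact: bp || exact: bD || apply: bmfX
    || apply: bmfM || apply: bmfD).
have f0 j : \int[unif]_x f j x = 0 by exact: Rintegral_rot_monomial.
transitivity (\sum_(j < d.+1) \int[unif]_x f j x); last first.
  by rewrite big1.
rewrite -bmf_Rintegral_sum//; apply: eq_Rintegral => x _.
have pe j : p (e j) x = svec x 0 j by rewrite /p dotpC dotp_delta.
have ez j : dotp (e j) z = z 0 j by rewrite dotpC dotp_delta.
(* Summed over [j], the coordinate products become [u], [w] and [x . x = 1]. The term free of [j]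
   occurs [d + 1] times; the sum of [z_j x_j] offsets one copy, leaving the factor [d]. *)
have fE j : f j x = (u x ^+ a * w x ^+ b) * (z 0 j * svec x 0 j)
    - u x * (u x ^+ a * w x ^+ b)
    + (a%:R * u x ^+ a.-1 * w x ^+ b) * (svec x 0 j * svec x 0 j)
    - (a%:R * u x ^+ a.-1 * w x ^+ b * u x) * (z 0 j * svec x 0 j)
    + (b%:R * u x ^+ a * w x ^+ b.-1 * dotp z y) * (svec x 0 j * svec x 0 j)
    - (b%:R * u x ^+ a * w x ^+ b.-1 * u x) * (y 0 j * svec x 0 j).
  rewrite /f /D pe ez e1 z1 !dotp_delta (dotpC y z) -[p z x]/(u x).
  ring.
under [RHS]eq_bigr do rewrite fE.
rewrite !(big_split, sumrN) /= -!mulr_sumr.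
rewrite sumr_const card_ord -!/(dotp _ _) dotp_svec -/(u x) -/(w x).
by rewrite -[_ *+ d.+1]mulr_natr; ring.
Qed.

(** The integrand is linear in [p] and in [q], so the monomial case suffices. *)
Lemma Rintegral_ibp z y (p q : {poly R}) : dotp z z = 1 ->
  let u x := dotp z (svec x) in let w x := dotp y (svec x) in
  \int[unif]_x ((1 - u x ^+ 2) * p^`().[u x] * q.[w x]
    + (dotp z y - u x * w x) * p.[u x] * q^`().[w x]
    - d%:R * u x * p.[u x] * q.[w x]) = 0.
Proof.
move=> z1 u w.
have bu : bmf u by exact: bmf_dotp.
have bw : bmf w by exact: bmf_dotp.
pose f (p q : {poly R}) x := (1 - u x ^+ 2) * p^`().[u x] * q.[w x]
    + (dotp z y - u x * w x) * p.[u x] * q^`().[w x]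
    - d%:R * u x * p.[u x] * q.[w x].
have bf p' q' : bmf (f p' q').
  by rewrite /f; bmf_tac.
have flinl c p1 p2 q' x : f (c *: p1 + p2) q' x = c * f p1 q' x + f p2 q' x.
  by rewrite /f !(derivD, derivZ) !(hornerD, hornerZ); ring.
have flinr c p' q1 q2 x : f p' (c *: q1 + q2) x = c * f p' q1 x + f p' q2 x.
  by rewrite /f !(derivD, derivZ) !(hornerD, hornerZ); ring.
have fX n m : \int[unif]_x f 'X^n 'X^m x = 0.
  rewrite -[RHS](Rintegral_ibp_monomial y n m z1); apply: eq_Rintegral => x _.
  rewrite /f !derivXn !hornerMn !hornerXn.
  by rewrite -[_ *+ n]mulr_natl -[_ *+ m]mulr_natl.
suff : \int[unif]_x f p q x = 0 by [].
clearbody f.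
apply: (@poly_linear_eq0 _ (fun p' => \int[unif]_x f p' q x)) => [c p1 p2|n].
  under eq_Rintegral do rewrite flinl.
  rewrite bmf_RintegralD ?bmf_RintegralZ//.
  by apply: bmfM => //; exact: bmf_cst.
apply: (@poly_linear_eq0 _ (fun q' => \int[unif]_x f 'X^n q' x)) => [c q1 q2|m].
  under eq_Rintegral do rewrite flinr.
  rewrite bmf_RintegralD ?bmf_RintegralZ//.
  by apply: bmfM => //; exact: bmf_cst.
exact: fX.
Qed.

End zonal.

(** * Zonal polynomials with two poles: orthogonality, moments and convolution *)

Section zonal_convolution.
Context (R : realType) (d : nat) (unif : probability (sphere R d) R).
Hypothesis hunif : is_unif unif.
Context (l : R).
Hypotheses (l0 : 0 <= l) (dl : d%:R = 2 * l + 1).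
Implicit Types (z : 'rV[R]_d.+1) (x eta zeta : sphere R d).

(* Integration by parts makes the ultraspherical operator symmetric even between
   zonal functions with different poles z and y. *)
Lemma Rintegral_Dpoly_orthogonal (n m : nat) z y : n != m ->
  dotp z z = 1 -> dotp y y = 1 ->
  \int[unif]_x ((Dpoly l n).[dotp z (svec x)] *
                (Dpoly l m).[dotp y (svec x)]) = 0.
Proof.
move=> nm z1 y1.
pose u x := dotp z (svec x); pose w x := dotp y (svec x).
have bu : bmf u by exact: bmf_dotp.
have bw : bmf w by exact: bmf_dotp.
pose lam k : R := k%:R * (k%:R + 2 * l).
pose f x := (Dpoly l n).[u x] * (Dpoly l m).[w x].
have bf : bmf f by rewrite /f; bmf_tac.
pose g x := (dotp z y - u x * w x) * (Dpoly l n)^`().[u x]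
            * (Dpoly l m)^`().[w x].
have bg : bmf g by rewrite /g; bmf_tac.
have ode k (t : R) : (1 - t ^+ 2) * (Dpoly l k)^`()^`().[t]
    = d%:R * t * (Dpoly l k)^`().[t] - lam k * (Dpoly l k).[t].
  have /(congr1 (horner^~ t)) := Dpoly_ode k l0.
  rewrite !(hornerD, hornerN, hornerM, hornerZ, hornerX, hornerXn) -/(lam k).
  rewrite -polyC1 hornerC dl => h.
  by rewrite -[LHS](subrK ((2 * l + 1) * (t * (Dpoly l k)^`().[t]))) h; ring.
(* Integration by parts is applied to [D_n'] and [D_m]; since [d = 2 l + 1], the differential
   equation absorbs the first-order term. Exchanging the roles of the poles gives the same [g],
   which cancels on subtraction. *)
have h1 : \int[unif]_x (- lam n * f x + g x) = 0.
  rewrite -[RHS](Rintegral_ibp hunif y (Dpoly l n)^`() (Dpoly l m) z1).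
  apply: eq_Rintegral => x _; rewrite -/(u x) -/(w x) ode /f /g.
  by ring.
have h2 : \int[unif]_x (- lam m * f x + g x) = 0.
  rewrite -[RHS](Rintegral_ibp hunif z (Dpoly l m)^`() (Dpoly l n) y1).
  apply: eq_Rintegral => x _; rewrite -/(u x) -/(w x) ode /f /g (dotpC y z).
  by ring.
have : (lam m - lam n) * \int[unif]_x f x = 0.
  rewrite -bmf_RintegralZ//.
  transitivity (\int[unif]_x ((- lam n * f x + g x) - (- lam m * f x + g x))).
    by apply: eq_Rintegral => x _; ring.
  by rewrite bmf_RintegralB ?h1 ?h2 ?subrr//; bmf_tac.
move/eqP; rewrite mulf_eq0 => /orP[|/eqP//].
(* As [l >= 0], the second factor vanishes only if [m = n = 0], so distinct degrees have distinct
   eigenvalues. *)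
rewrite /lam (_ : _ - _ = (m%:R - n%:R) * (m%:R + n%:R + 2 * l)); last by ring.
rewrite mulf_eq0 subr_eq0 eqr_nat eq_sym (negbTE nm) /= => /eqP mnl.
exfalso; move: nm; suff [-> ->] : n = 0%N /\ m = 0%N by [].
have : (m%:R + n%:R : R) <= 0 by rewrite -mnl lerDl mulr_ge0.
by rewrite -natrD lern0 addn_eq0 => /andP[/eqP -> /eqP ->].
Qed.

Lemma Rintegral_monomial_rec z y (a b : nat) : dotp z z = 1 ->
  let W i j := \int[unif]_x (dotp z (svec x) ^+ i * dotp y (svec x) ^+ j) in
  (a%:R + b%:R + d%:R) * W a.+1 b
    = a%:R * W a.-1 b + b%:R * dotp z y * W a b.-1.
Proof.
move=> z1 W.
pose u x := dotp z (svec x); pose w x := dotp y (svec x).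
have bu : bmf u by exact: bmf_dotp.
have bw : bmf w by exact: bmf_dotp.
pose m i j x := u x ^+ i * w x ^+ j.
have bm i j : bmf (m i j) by rewrite /m; bmf_tac.
have := Rintegral_ibp_monomial hunif y a b z1; rewrite /= => h.
have : \int[unif]_x (a%:R * m a.-1 b x + b%:R * dotp z y * m a b.-1 x
   - (a%:R + b%:R + d%:R) * m a.+1 b x) = 0.
  rewrite -[RHS]h; apply: eq_Rintegral => x _.
  rewrite -/(u x) -/(w x) /m.
  by case: (a) (b) => [|a'] [|b'] /=; rewrite ?exprS; ring.
have bmc c i j : bmf (fun x => c * m i j x).
  by apply: bmfM => //; exact: bmf_cst.
rewrite bmf_RintegralB//; last exact: bmfD.
rewrite bmf_RintegralD// !bmf_RintegralZ// => /eqP; rewrite subr_eq0 => /eqP ->.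
by [].
Qed.

(** Induction along [Rintegral_monomial_rec]: a factor [z . y] appears only when [b] drops by one,
    which yields the degree bound. The case [a = 0] is an induction on [b] after exchanging the two
    poles. *)
Lemma Rintegral_monomial_poly (a b : nat) : exists Q : {poly R},
  (size Q <= b.+1)%N /\ forall z y, dotp z z = 1 -> dotp y y = 1 ->
    \int[unif]_x (dotp z (svec x) ^+ a * dotp y (svec x) ^+ b) = Q.[dotp z y].
Proof.
have d0 i j : (i%:R + j%:R + d%:R : R) != 0.
  by rewrite dl gt_eqF// ltr_wpDl// ltr_wpDl// mulr_ge0.
pose W (z y : 'rV[R]_d.+1) i j :=
  \int[unif]_x (dotp z (svec x) ^+ i * dotp y (svec x) ^+ j).
have WC z y i j : W z y i j = W y z j i.
  by apply: eq_Rintegral => x _; rewrite mulrC.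
have Wrec z y i j (z1 : dotp z z = 1) : W z y i.+1 j =
    (i%:R + j%:R + d%:R)^-1 *
    (i%:R * W z y i.-1 j + j%:R * dotp z y * W z y i j.-1).
  by rewrite -(Rintegral_monomial_rec y i j z1) -/(W z y i.+1 j) mulKf.
pose P i := forall j, exists Q : {poly R}, (size Q <= j.+1)%N /\
  forall z y, dotp z z = 1 -> dotp y y = 1 -> W z y i j = Q.[dotp z y].
suff [_ Pa] : P a.-1 /\ P a by exact: Pa.
have P0 : P 0%N.
  elim/nat_ind2 => [||j [Q [sQ hQ]] _].
  - exists 1; rewrite size_poly1; split => // z y z1 y1.
    rewrite hornerC -[RHS](Rintegral_prob_cst unif); apply: eq_Rintegral => x _.
    by rewrite !expr0 mulr1.
  - exists 0; rewrite size_poly0; split => // z y z1 y1.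
    by rewrite WC Wrec// !mul0r addr0 mulr0 horner0.
  - exists ((j.+1%:R + 0%:R + d%:R)^-1 *: (j.+1%:R *: Q)); split.
      rewrite (leq_trans (size_scale_leq _ _))//.
      by rewrite (leq_trans (size_scale_leq _ _))// (leq_trans sQ)// ltnS leqW.
    move=> z y z1 y1; rewrite WC Wrec// !mul0r addr0.
    by rewrite !hornerZ -(hQ z y)// addr0 (WC z y).
elim: a {b} => [//|a [IH' IH]]; split => // b.
have [Q1 [s1 h1]] := IH' b; have [Q2 [s2 h2]] := IH b.-1.
exists ((a%:R + b%:R + d%:R)^-1 *: (a%:R *: Q1 + b%:R *: ('X * Q2))); split.
  rewrite (leq_trans (size_scale_leq _ _))// (leq_trans (size_polyD _ _))//.
  rewrite geq_max (leq_trans (size_scale_leq _ _) s1) /=.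
  (* At [b = 0] the truncated [b.-1] would spoil the bound, but the coefficient [b%:R] is then
     zero. *)
  case: b s2 {s1 h1 h2} => [|b] s2; first by rewrite scale0r size_poly0.
  rewrite (leq_trans (size_scale_leq _ _))// (leq_trans (size_polyMleq _ _))//.
  by rewrite size_polyX.
move=> z y z1 y1; rewrite Wrec// h1// h2//.
by rewrite !(hornerZ, hornerD, hornerM, hornerX) mulrA.
Qed.

Lemma Rintegral_horner_poly (p q : {poly R}) : exists Q : {poly R},
  (size Q <= size q)%N /\ forall z y, dotp z z = 1 -> dotp y y = 1 ->
    \int[unif]_x (p.[dotp z (svec x)] * q.[dotp y (svec x)]) = Q.[dotp z y].
Proof.
have [Q QP] := choice (fun ij : nat * nat => Rintegral_monomial_poly ij.1 ij.2).
exists (\sum_(j < size q) \sum_(i < size p)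
  (p`_i * q`_j) *: Q (nat_of_ord i, nat_of_ord j)); split.
  apply: (leq_trans (size_sum _ _ _)); apply/bigmax_leqP => j _.
  apply: (leq_trans (size_sum _ _ _)); apply/bigmax_leqP => i _.
  exact: leq_trans (leq_trans (size_scale_leq _ _) (QP (_, _)).1) (ltn_ord j).
move=> z y z1 y1; rewrite horner_sum.
have bz : bmf (fun x => dotp z (svec x)) by exact: bmf_dotp.
have by' : bmf (fun x => dotp y (svec x)) by exact: bmf_dotp.
under eq_Rintegral => x _.
  rewrite (horner_coef q) mulr_sumr; under eq_bigr => j _.
    rewrite (horner_coef p) mulr_suml; over.
  over.
have bt (i j : nat) : bmf (fun x => p`_i * dotp z (svec x) ^+ i *
    (q`_j * dotp y (svec x) ^+ j)) by bmf_tac.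
rewrite bmf_Rintegral_sum; last by move=> j; apply: bmf_sum.
apply: eq_bigr => j _; rewrite bmf_Rintegral_sum// horner_sum.
apply: eq_bigr => i _.
rewrite hornerZ -(QP (_, _)).2// -bmf_RintegralZ; last by bmf_tac.
by apply: eq_Rintegral => x _; ring.
Qed.

Lemma Rintegral_Dpoly_sqr (n : nat) z : dotp z z = 1 ->
  \int[unif]_x ((Dpoly l n).[dotp z (svec x)] * (Dpoly l n).[dotp z (svec x)])
    = gammac l n.
Proof.
move=> z1.
pose u x := dotp z (svec x).
have bu : bmf u by exact: bmf_dotp.
pose p n x := (Dpoly l n).[u x].
have bp k : bmf (p k) by rewrite /p; bmf_tac.
have orth i j : i != j -> \int[unif]_x (p i x * p j x) = 0.
  by move=> ij; exact: Rintegral_Dpoly_orthogonal.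
have rec i x : (i%:R + 2 * l + 1) * p i.+2 x =
    2 * (i%:R + l + 1) * (u x * p i.+1 x) - i.+1%:R * p i x.
  have /(congr1 (horner^~ (u x))) := Dpoly_rec i l0.
  by rewrite hornerD hornerN !hornerZ hornerM hornerX.
rewrite -/(\int[unif]_x (p n x * p n x)).
elim/nat_ind2: n => [||n _ IH].
- rewrite gammac0 -[RHS](Rintegral_prob_cst unif); apply: eq_Rintegral => x _.
  by rewrite /p Dpoly0 hornerC mulr1.
- have W0 : \int[unif]_x (dotp z (svec x) ^+ 0 * dotp z (svec x) ^+ 0) = 1.
    rewrite -[RHS](Rintegral_prob_cst unif); apply: eq_Rintegral => x _.
    by rewrite !expr0 mulr1.
  have e0 : 1 + 0 + d%:R != 0 :> R.
    by rewrite dl gt_eqF// addr0 ltr_pwDl// addr_ge0// mulr_ge0.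
  apply: (mulfI e0); transitivity (1 : R).
    have := Rintegral_monomial_rec z 1 0 z1.
    rewrite /= W0 [X in _ = X](_ : _ = 1); last by rewrite !mul0r mulr1 addr0.
    move=> h; rewrite -[RHS]h; congr (_ * _); apply: eq_Rintegral => x _.
    by rewrite /p Dpoly1 hornerX /u expr0 mulr1 expr2.
  by rewrite dl gammac1//; field; rewrite gt_eqF// ltr_wpDl// mulr_ge0.
have bux i j : bmf (fun x => u x * p i x * p j x).
  by apply: bmfM => //; exact: bmfM.
have bpp i j : bmf (fun x => p i x * p j x) by exact: bmfM.
(* [K] is computed twice, from the recurrence at [n] times [D_(n+2)] and from that at [n + 1] times
   [D_(n+1)]. Orthogonality removes the mixed terms and links consecutive second moments as in
   [gammacSS]. *)
pose K := \int[unif]_x (u x * p n.+1 x * p n.+2 x).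
have h1 : (n%:R + 2 * l + 1) * \int[unif]_x (p n.+2 x * p n.+2 x) =
    2 * (n%:R + l + 1) * K.
  rewrite -bmf_RintegralZ//.
  transitivity (\int[unif]_x (2 * (n%:R + l + 1) * (u x * p n.+1 x * p n.+2 x)
      - n.+1%:R * (p n x * p n.+2 x))).
    by apply: eq_Rintegral => x _; rewrite [LHS]mulrA rec; ring.
  rewrite bmf_RintegralB; [|by bmf_tac|by bmf_tac].
  by rewrite !bmf_RintegralZ// orth ?mulr0 ?subr0// neq_ltn ltnW.
have h2 : 2 * (n%:R + l + 2) * K = n.+2%:R * gammac l n.+1.
  have : \int[unif]_x (2 * (n%:R + l + 2) * (u x * p n.+1 x * p n.+2 x)
      - n.+2%:R * (p n.+1 x * p n.+1 x)) = 0.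
    rewrite -[RHS](mulr0 (n.+1%:R + 2 * l + 1)) -(@orth n.+3 n.+1); last first.
      by rewrite neq_ltn leqnSn orbT.
    rewrite -bmf_RintegralZ//; apply: eq_Rintegral => x _.
    by rewrite [RHS]mulrA rec; ring.
  rewrite bmf_RintegralB; [|by bmf_tac|by bmf_tac].
  rewrite !bmf_RintegralZ// IH.
  by move/eqP; rewrite subr_eq0 => /eqP.
have e0 : (n%:R + 2 * l + 1) * (n%:R + l + 2) != 0.
  by rewrite gt_eqF// mulr_gt0// ltr_wpDl// addr_ge0// mulr_ge0.
apply: (mulfI e0); rewrite gammacSS//.
transitivity ((n%:R + l + 1) * (2 * (n%:R + l + 2) * K)).
  by rewrite mulrAC h1; ring.
by rewrite h2 mulrA.
Qed.

Lemma bmf_horner_dotp2 (p : {poly R}) :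
  bmf (fun z : sphere R d * sphere R d => p.[dotp (svec z.1) (svec z.2)]).
Proof. by apply: bmf_horner; exact: bmf_dotp2. Qed.

Lemma Rintegral_Dpoly_zonal (n : nat) eta x :
  \int[unif]_zeta ((Dpoly l n).[dotp (svec eta) (svec zeta)] *
                (Dpoly l n).[dotp (svec x) (svec zeta)])
    = gammac l n * (Dpoly l n).[dotp (svec eta) (svec x)].
Proof.
have [Q [sQ QE]] := Rintegral_horner_poly (Dpoly l n) (Dpoly l n).
have {}QE y x' : \int[unif]_zeta ((Dpoly l n).[dotp (svec y) (svec zeta)] *
    (Dpoly l n).[dotp (svec x') (svec zeta)]) = Q.[dotp (svec y) (svec x')].
  by rewrite QE ?dotp_svec.
rewrite size_Dpoly// in sQ.
have [s Qs] := Dpoly_span l0 sQ.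
pose p k y := (Dpoly l k).[dotp (svec eta) (svec y)].
have bp k : bmf (p k) by apply: bmf_horner; exact: bmf_dotp.
(* Unfolding [Q] into an integral and exchanging the order leaves an inner integral of [D_m] and
   [D_n] with poles [eta] and [zeta], which vanishes. *)
have Qorth m : m != n ->
      \int[unif]_y (Q.[dotp (svec eta) (svec y)] * p m y) = 0.
  move=> mn.
  pose f (w : sphere R d * sphere R d) :=
    p m w.1 * (p n w.2 * (Dpoly l n).[dotp (svec w.1) (svec w.2)]).
  have bf : bmf f.
    apply: bmfM; first exact: (@bmf_fst _ _ _ (sphere R d) _ _ (bp m)).
    apply: bmfM; last exact: bmf_horner_dotp2.
    exact: (@bmf_snd _ _ (sphere R d) _ _ _ (bp n)).
  transitivity (\int[unif]_y \int[unif]_zeta f (y, zeta)).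
    apply: eq_Rintegral => y _; rewrite mulrC -QE -bmf_RintegralZ//.
    by apply: bmfM => //; apply: bmf_horner; exact: bmf_dotp.
  rewrite bmf_Rintegral_swap// -[RHS](Rintegral_prob_cst unif).
  apply: eq_Rintegral => zeta _.
  transitivity (\int[unif]_y (p n zeta * (p m y *
      (Dpoly l n).[dotp (svec zeta) (svec y)]))).
    by apply: eq_Rintegral => y _; rewrite /f /= (dotpC (svec y)); ring.
  rewrite bmf_RintegralZ; last first.
    by apply: bmfM => //; apply: bmf_horner; exact: bmf_dotp.
  by rewrite Rintegral_Dpoly_orthogonal ?dotp_svec ?mulr0.
have Qp (m : 'I_n.+1) : \int[unif]_y (Q.[dotp (svec eta) (svec y)] * p m y)
    = s m * gammac l m.
  transitivity (\int[unif]_y (\sum_(k < n.+1) s k * (p k y * p m y))).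
    apply: eq_Rintegral => y _; rewrite {1}Qs horner_sum mulr_suml.
    by apply: eq_bigr => k _; rewrite hornerZ mulrA.
  have bkm (k : 'I_n.+1) : bmf (fun y => s k * (p k y * p m y)).
    by apply: bmfM; [exact: bmf_cst|exact: bmfM].
  rewrite bmf_Rintegral_sum// (bigD1 m)//= bmf_RintegralZ; last exact: bmfM.
  rewrite Rintegral_Dpoly_sqr ?dotp_svec// big1 ?addr0// => k km.
  rewrite bmf_RintegralZ; last exact: bmfM.
  by rewrite Rintegral_Dpoly_orthogonal ?dotp_svec ?mulr0.
have s0 (m : 'I_n.+1) : m != ord_max -> s m = 0.
  move=> mn; have := Qp m; rewrite Qorth// => /esym/eqP.
  by rewrite mulf_eq0 (gt_eqF (gammac_gt0 m l0)) orbF => /eqP.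
have QP : Q = s n *: Dpoly l n.
  rewrite Qs (bigD1 ord_max)//= big1 ?addr0// => m mn.
  by rewrite s0// scale0r.
(* Taking both poles equal to [eta] evaluates [Q] at 1, where [D_n] is 1. *)
have sn : s n = gammac l n.
  have := QE eta eta; rewrite Rintegral_Dpoly_sqr ?dotp_svec// => ->.
  by rewrite QP hornerZ Dpoly_at1// mulr1.
by rewrite QE QP hornerZ sn.
Qed.

(** A Cauchy-Schwarz argument: by [Rintegral_Dpoly_zonal], [gammac l n] times the value at [eta . x]
    is the inner product of two functions of squared norm [gammac l n]. *)
Lemma Dpoly_le1 (n : nat) eta x :
  `|(Dpoly l n).[dotp (svec eta) (svec x)]| <= 1.
Proof.
pose p (y z : sphere R d) := (Dpoly l n).[dotp (svec y) (svec z)].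
have bp y : bmf (p y) by apply: bmf_horner; exact: bmf_dotp.
have g0 := gammac_gt0 n l0.
have pp y (z : sphere R d) :
    \int[unif]_zeta (p y zeta * p z zeta) = gammac l n * p y z.
  exact: Rintegral_Dpoly_zonal.
have p1 y : p y y = 1 by rewrite /p dotp_svec Dpoly_at1.
have key c : 0 <= gammac l n * (1 + c ^+ 2 + 2 * c * p eta x).
  have <- : \int[unif]_zeta ((p eta zeta + c * p x zeta) ^+ 2)
      = gammac l n * (1 + c ^+ 2 + 2 * c * p eta x).
    transitivity (\int[unif]_zeta (p eta zeta * p eta zeta
       + c ^+ 2 * (p x zeta * p x zeta) + 2 * c * (p eta zeta * p x zeta))).
      by apply: eq_Rintegral => zeta _; ring.
    have bpp y (z : sphere R d) : bmf (fun zeta => p y zeta * p z zeta).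
      exact: bmfM.
    have bc k y (z : sphere R d) : bmf (fun zeta => k * (p y zeta * p z zeta)).
      by apply: bmfM; [exact: bmf_cst|].
    rewrite bmf_RintegralD//; last exact: bmfD.
    by rewrite bmf_RintegralD// !bmf_RintegralZ// !pp !p1; ring.
  by apply: Rintegral_ge0 => zeta _; exact: sqr_ge0.
rewrite -/(p eta x) ler_norml.
have := key 1; have := key (-1); rewrite !pmulr_rge0// => h1 h2.
by apply/andP; split; lra.
Qed.

End zonal_convolution.

(** * The distributions Delta *)

Section Delta_theory.
Context (R : realType) (d : nat) (unif : probability (sphere R d) R).
Hypothesis hunif : is_unif unif.
Context (l : R).
Hypotheses (l0 : 0 <= l) (dl : d%:R = 2 * l + 1).
Implicit Types (x eta zeta : sphere R d) (A : set (sphere R d)).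

Let p n eta x := (Dpoly l n).[dotp (svec eta) (svec x)].

Let bp n eta : bmf (p n eta).
Proof. by apply: bmf_horner; exact: bmf_dotp. Qed.

Let pC n eta x : p n eta x = p n x eta.
Proof. by rewrite /p dotpC. Qed.

(** The boolean factor lets one formula cover the convention that index 0 gives the uniform law. *)
Let dens n eta beta x := 1 + (n != 0%N)%:R * beta * p n eta x.

Let bdens n eta beta : bmf (dens n eta beta).
Proof. by rewrite /dens; bmf_tac. Qed.

Let zonal_mass A n eta := \int[unif]_x (\1_A x * p n eta x).

Lemma bmf_zonal_mass A n : measurable A -> bmf (zonal_mass A n).
Proof.
move=> mA.
apply: (@bmf_Rintegral _ _ _ _ _ unif unif (fun w => \1_A w.2 * p n w.1 w.2)).
apply: bmfM; last exact: bmf_horner_dotp2.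
exact: (@bmf_snd _ _ (sphere R d) _ _ _ (bmf_indic R mA)).
Qed.

(** Fubini moves the integral over [zeta] inside, onto a product of zonal polynomials with poles
    [eta] and [x]. *)
Lemma Rintegral_zonal_massM A n m eta : measurable A ->
  \int[unif]_zeta (zonal_mass A m zeta * p n eta zeta) =
  (m == n)%:R * gammac l n * zonal_mass A n eta.
Proof.
move=> mA; have b1 := bmf_indic R mA.
pose f (w : sphere R d * sphere R d) := \1_A w.2 * p m w.1 w.2 * p n eta w.1.
have bf : bmf f.
  apply: bmfM; last exact: (@bmf_fst _ _ _ (sphere R d) _ _ (bp n eta)).
  apply: bmfM; last exact: bmf_horner_dotp2.
  exact: (@bmf_snd _ _ (sphere R d) _ _ _ b1).
transitivity (\int[unif]_zeta \int[unif]_x f (zeta, x)).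
  apply: eq_Rintegral => zeta _.
  rewrite mulrC -bmf_RintegralZ; last exact: bmfM.
  by apply: eq_Rintegral => x _; rewrite /f /=; ring.
rewrite bmf_Rintegral_swap// /zonal_mass -bmf_RintegralZ; last exact: bmfM.
apply: eq_Rintegral => x _.
transitivity (\int[unif]_zeta (\1_A x * (p n eta zeta * p m x zeta))).
  by apply: eq_Rintegral => zeta _; rewrite /f /= (pC m zeta); ring.
rewrite bmf_RintegralZ; last exact: bmfM.
have [->|mn] := eqVneq m n.
  by rewrite Rintegral_Dpoly_zonal// mul1r mulrCA.
by rewrite Rintegral_Dpoly_orthogonal ?dotp_svec ?mulr0 ?mul0r// eq_sym.
Qed.

Lemma dens_ge0 n eta beta x : -1 <= beta <= 1 -> 0 <= dens n eta beta x.
Proof.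
move=> /andP[b1 b2]; rewrite /dens; case: (n != 0%N); last first.
  by rewrite !mul0r addr0 ler01.
have : `|beta * p n eta x| <= 1.
  rewrite normrM mulr_ile1//; first by rewrite ler_norml b1 b2.
  exact: (Dpoly_le1 hunif l0 dl).
by rewrite ler_norml mul1r => /andP[? _]; lra.
Qed.

(** Exhibits [Delta] as affine in [beta], for every real [beta]; the mixture form in part (a) then
    becomes a ring identity. *)
Lemma DeltaE n eta beta A : measurable A ->
  Delta unif l n eta beta A =
  (fine (unif A) + (n != 0%N)%:R * beta * zonal_mass A n eta)%:E.
Proof.
move=> mA; have b1 := bmf_indic R mA.
have -> : Delta unif l n eta beta A =
    (\int[unif]_(x in A) (dens n eta beta x)%:E)%E.
  rewrite /Delta /dens; case: n => [|n] /=; last first.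
    by under [RHS]eq_integral do rewrite mul1r.
  under eq_integral do rewrite !mul0r addr0.
  by rewrite integral_cst// mul1e.
rewrite -EFin_Rintegral//; congr _%:E; rewrite Rintegral_mkcond.
transitivity (\int[unif]_x (\1_A x +
                (n != 0%N)%:R * beta * (\1_A x * p n eta x))).
  apply: eq_Rintegral => x _; rewrite patchE indicE /dens.
  by case: ifP => _; rewrite ?mul1r ?mul0r ?mulr0 ?addr0.
have b2 : bmf (fun x => \1_A x * p n eta x) by exact: bmfM.
rewrite bmf_RintegralD ?bmf_RintegralZ//; last first.
  by apply: bmfM => //; exact: bmf_cst.
by rewrite {1}/Rintegral integral_indic// setIT.
Qed.

Lemma integral_Delta n eta beta (f : sphere R d -> R) :
  -1 <= beta <= 1 -> bmf f ->
  (\int[Delta unif l n eta beta]_zeta (f zeta)%:E)%E =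
  (\int[unif]_zeta (f zeta * dens n eta beta zeta))%:E.
Proof.
move=> beta1 bf; rewrite EFin_Rintegral//; last exact: bmfM.
case: n => [|n].
  have -> : Delta unif l 0 eta beta = unif by [].
  by apply: eq_integral => x _; rewrite /dens !mul0r addr0 mulr1.
have -> : Delta unif l n.+1 eta beta =
    fun A => (\int[unif]_(x in A) (dens n.+1 eta beta x)%:E)%E.
  apply/funext => A; rewrite /Delta /dens /=.
  by under [RHS]eq_integral do rewrite mul1r.
by rewrite integral_bmf_density// => x; exact: dens_ge0.
Qed.

Lemma integral_Delta_Delta n m eta alpha beta A :
  -1 <= beta <= 1 -> measurable A ->
  (\int[Delta unif l n eta beta]_zeta Delta unif l m zeta alpha A)%E =
  (fine (unif A) + (m == n)%:R * (n != 0%N)%:R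
     * (gammac l n * alpha * beta) * zonal_mass A n eta)%:E.
Proof.
move=> beta1 mA.
have bI k : bmf (zonal_mass A k) by exact: bmf_zonal_mass.
under eq_fun do rewrite DeltaE//.
rewrite integral_Delta//; last by bmf_tac.
congr _%:E.
set a := (m != 0%N)%:R * alpha; set b := (n != 0%N)%:R * beta.
(* Writing the constant 1 as [D_0] turns the cross terms into cases of orthogonality and of
   [Rintegral_zonal_massM]; at index 0 the boolean factors in [a] and [b] remove what survives. *)
have p0 x : p 0 eta x = 1 by rewrite /p Dpoly0 hornerC.
transitivity (\int[unif]_zeta (fine (unif A) * (p n eta zeta * p 0 eta zeta) * b
  + a * (zonal_mass A m zeta * p 0 eta zeta)
  + a * b * (zonal_mass A m zeta * p n eta zeta) + fine (unif A))).
  apply: eq_Rintegral => zeta _; rewrite /dens -/b p0; ring.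
have bpp : bmf (fun zeta => p n eta zeta * p 0 eta zeta) by exact: bmfM.
have bIp k : bmf (fun zeta => zonal_mass A m zeta * p k eta zeta).
  exact: bmfM.
rewrite bmf_RintegralD; [|by bmf_tac|exact: bmf_cst].
rewrite bmf_RintegralD; [|by bmf_tac|by bmf_tac].
rewrite bmf_RintegralD; [|by bmf_tac|by bmf_tac].
rewrite Rintegral_prob_cst !bmf_RintegralZ// !Rintegral_zonal_massM//.
under eq_Rintegral do rewrite mulrAC.
rewrite bmf_RintegralZ//.
have -> : fine (unif A) * b * \int[unif]_zeta (p n eta zeta * p 0 eta zeta) = 0.
  rewrite /b; case: eqVneq => [_|n0]; first by rewrite mul0r mulr0 mul0r.
  by rewrite Rintegral_Dpoly_orthogonal ?dotp_svec ?mulr0.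
have -> : a * ((m == 0%N)%:R * gammac l 0 * zonal_mass A 0 eta) = 0.
  by rewrite /a; case: eqVneq => _; rewrite ?mul0r ?mulr0.
rewrite /a /b; case: (eqVneq m n) => [->|_] /=; last by ring.
by case: (n != 0%N) => /=; ring.
Qed.

End Delta_theory.

Local Open Scope ereal_scope.

Theorem proposition12 (R : realType) (d : nat) (hd : (1 <= d)%N)
    (l : R) (hl : l = ((d%:R - 1) / 2)%R)
    (unif : probability (sphere R d) R) (hunif : is_unif unif) :
  (forall (n : nat) (eta : sphere R d) (alpha beta : R),
     (-1 <= alpha <= 1)%R -> (-1 <= beta <= 1)%R ->
     forall A : set (sphere R d), measurable A ->
       \int[Delta unif l n eta beta]_zeta Delta unif l n zeta alpha A
         = Delta unif l n eta (gammac l n * alpha * beta)%R A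
       /\
       Delta unif l n eta (gammac l n * alpha * beta)%R A
         = (1 - gammac l n)%R%:E * unif A
           + (gammac l n)%:E * Delta unif l n eta (alpha * beta)%R A)
  /\
  (forall (n m : nat), n <> m ->
     forall (eta : sphere R d) (alpha beta : R),
     (-1 <= alpha <= 1)%R -> (-1 <= beta <= 1)%R ->
     forall A : set (sphere R d), measurable A ->
       \int[Delta unif l n eta beta]_zeta Delta unif l m zeta alpha A
         = unif A).
Proof.
have l0 : (0 <= l)%R.
  by rewrite hl divr_ge0// subr_ge0 ler1n.
have dl : (d%:R = 2 * l + 1)%R by rewrite hl; field.
split=> [n eta alpha beta _ beta1 A mA|n m nm eta alpha beta _ beta1 A mA].
  rewrite (integral_Delta_Delta hunif l0 dl)// !(DeltaE unif l)// eqxx mul1r.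
  split=> //; rewrite -[unif A]fineK ?fin_num_measure// -!EFinM -EFinD.
  by congr _%:E; ring.
rewrite (integral_Delta_Delta hunif l0 dl)//.
have /eqP/negbTE -> : m <> n by move/esym.
by rewrite !mul0r addr0 fineK// fin_num_measure.
Qed.
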